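(* Let $x$ be feasible for (VP) and let $(u,y,z^1,\dots,z^p,\lambda)$ be feasible for (Mix D), where (VP) and (Mix D) are the problems defined in the context. Suppose there is a function $\eta$ such that, for all feasible $x$ of (VP) and all feasible $(u,y,z^1,\dots,z^p,\lambda)$ of (Mix D), the functional $$\sum_{i=1}^{p}\lambda^i\int_I\Big(f^i(t,\cdot,\cdot,\cdot)+\sum_{j\in J_0}y^j(t)g^j(t,\cdot,\cdot,\cdot)+(\cdot)^TB^i(t)z^i(t)\Big)dt$$ is pseudoinvex with respect to $\eta$, and for each $\alpha=1,\dots,r$ the functional $$\sum_{j\in J_\alpha}\int_I y^j(t)g^j(t,\cdot,\cdot,\cdot)\,dt$$ is quasi-invex with respect to the same $\eta$. Then the following two conditions cannot hold simultaneously: (i) for all $i\in\{1,\dots,p\}$, $$\int_I\Big(f^i(t,x,\dot x,\ddot x)+\big(x(t)^TB^i(t)x(t)\big)^{1/2}\Big)dt\le\int_I\Big(f^i(t,u,\dot u,\ddot u)+u(t)^TB^i(t)z^i(t)+\sum_{j\in J_0}y^j(t)g^j(t,u,\dot u,\ddot u)\Big)dt;$$ (ii) for some $k\in\{1,\dots,p\}$, $$\int_I\Big(f^k(t,x,\dot x,\ddot x)+\big(x(t)^TB^k(t)x(t)\big)^{1/2}\Big)dt<\int_I\Big(f^k(t,u,\dot u,\ddot u)+u(t)^TB^k(t)z^k(t)+\sum_{j\in J_0}y^j(t)g^j(t,u,\dot u,\ddot u)\Big)dt.$$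
   Context: Setting. $I=[a,b]$ is a real interval; $P=\{1,\dots,p\}$, $M=\{1,\dots,m\}$. The functions $f^i:I\times\mathbb R^n\times\mathbb R^n\times\mathbb R^n\to\mathbb R$ ($i\in P$) and $g=(g^1,\dots,g^m):I\times\mathbb R^n\times\mathbb R^n\times\mathbb R^n\to\mathbb R^m$ are continuously differentiable; for each $i\in P$ and $t\in I$, $B^i(t)$ is a symmetric positive semidefinite $n\times n$ matrix, continuous in $t$. For $\phi(t,x,\dot x,\ddot x)$, the symbols $\phi_x,\phi_{\dot x},\phi_{\ddot x}$ denote the gradients with respect to the second, third and fourth arguments. $D=d/dt$ (except at discontinuities). Primal variables $x:I\to\mathbb R^n$ are piecewise smooth functions possessing first and second derivatives $\dot x,\ddot x$. Vector inequalities $\leqq$, $\geqq$, $>$ are componentwise. Write $\lambda^Tf=\sum_i\lambda^if^i$. Problem (VP): minimize the vector with components $\int_I\big(f^i(t,x,\dot x,\ddot x)+(x(t)^TB^i(t)x(t))^{1/2}\big)dt$, $i=1,\dots,p$, subject to $x(a)=0=x(b)$, $\dot x(a)=0=\dot x(b)$, $g(t,x,\dot x,\ddot x)\leqq 0$ for $t\in I$. The sets $J_\alpha\subseteq M$, $\alpha=0,1,\dots,r$, satisfy $\bigcup_{\alpha=0}^rJ_\alpha=M$ and $J_\alpha\cap J_\beta=\emptyset$ for $\alpha\ne\beta$. Problem (Mix D): maximize the vector with components $\int_I\big(f^i(t,u,\dot u,\ddot u)+u(t)^TB^i(t)z^i(t)+\sum_{j\in J_0}y^j(t)g^j(t,u,\dot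 u,\ddot u)\big)dt$, $i=1,\dots,p$, over $(u,y,z^1,\dots,z^p,\lambda)$ with $u:I\to\mathbb R^n$, $y:I\to\mathbb R^m$, $z^i:I\to\mathbb R^n$, $\lambda\in\mathbb R^p$, subject to: $u(a)=0=u(b)$; $\dot u(a)=0=\dot u(b)$; $$\sum_{i=1}^p\lambda^i\big(f^i_u+B^i(t)z^i(t)+y(t)^Tg_u\big)-D\big(\lambda^Tf_{\dot u}+y(t)^Tg_{\dot u}\big)+D^2\big(\lambda^Tf_{\ddot u}+y(t)^Tg_{\ddot u}\big)=0,\quad t\in I,$$ (all functions evaluated at $(t,u,\dot u,\ddot u)$); $\sum_{j\in J_\alpha}\int_Iy^j(t)g^j(t,u,\dot u,\ddot u)\,dt\ge0$ for $\alpha=1,\dots,r$; $z^i(t)^TB^i(t)z^i(t)\le1$ for $t\in I$, $i\in P$; $y(t)\geqq0$ for $t\in I$; and $\lambda>0$, $\lambda^Te=1$, where $e=(1,\dots,1)^T\in\mathbb R^p$. Generalized invexity. Let $\eta=\eta(t,x,u)\in\mathbb R^n$ be a vector function (with $D\eta,D^2\eta$, taken along $t\mapsto\eta(t,x(t),u(t))$, well defined) such that $\eta=0$ at every $t$ with $x(t)=u(t)$ and $D\eta=0$ at every $t$ with $\dot x(t)=\dot u(t)$. For a scalar function $\phi(t,x,\dot x,\ddot x)$, let $\Phi(x)=\int_I\phi(t,x,\dot x,\ddot x)\,dt$ and $\Delta(x,u)=\int_I\{\eta^T\phi_x(t,u,\dot u,\ddot u)+(D\eta)^T\phi_{\dot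 x}(t,u,\dot u,\ddot u)+(D^2\eta)^T\phi_{\ddot x}(t,u,\dot u,\ddot u)\}dt$. $\Phi$ is pseudoinvex with respect to $\eta$ if $\Delta(x,u)\ge0$ implies $\Phi(x)\ge\Phi(u)$; it is quasi-invex with respect to $\eta$ if $\Phi(x)\le\Phi(u)$ implies $\Delta(x,u)\le0$. For the functionals in the claim, $\lambda,y,z^i$ are held fixed and $(\cdot)$ stands for the argument function (and its derivatives). *)

(* Defs.v *)
From HB Require Import structures.
From mathcomp Require Import all_boot all_order all_algebra.
From mathcomp Require Import all_classical all_reals all_analysis.
Set Implicit Arguments.
Unset Strict Implicit.
Unset Printing Implicit Defensive.
Import Order.TTheory GRing.Theory Num.Theory.
Import numFieldNormedType.Exports.
Local Open Scope classical_set_scope.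
Local Open Scope ring_scope.

(* All functions of time are total on R; only their values on [a, b] matter. *)

Section Defs.
Context {R : realType}.

Definition dotv n (u v : 'cV[R]_n) : R := (u^T *m v) 0 0.

Definition integ (a b : R) (h : R -> R) : R :=
  \int[lebesgue_measure]_(t in `[a, b]) h t.

(* Continuous on ]a, b[ off a finite set, with finite one-sided limits
   everywhere in [a, b]. *)
Definition piecewise_continuous (W : normedModType R) (a b : R) (v : R -> W) :=
  [/\ exists S : seq R,
        forall t, t \in `]a, b[ -> t \notin S -> {for t, continuous v},
      forall t, t \in `[a, b[ -> cvg (v @ t^'+)
    & forall t, t \in `]a, b] -> cvg (v @ t^'-)].

(* [is_D a b w v] means "D w = v on [a, b]": w is piecewise smooth, and
   D = d/dt except at the discontinuities of the derivative v.  The function w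
   itself has no jump, so D inverts integration: w(t) = w(a) + \int_a^t v.  The
   values of v at its discontinuities (and at a and b when v is not continuous
   there) are left free. *)
Definition is_D (W : normedModType R) (a b : R) (w v : R -> W) :=
  [/\ {within `[a, b], continuous w},
      piecewise_continuous a b v
    & forall t, t \in `]a, b[ -> {for t, continuous v} ->
        is_derive t (1 : R) w (v t)].

(* A piecewise smooth trajectory [a, b] -> R^n together with its first and
   second derivatives; [velocityP] and [accelerationP] force the velocity to be
   continuous on [a, b] and the acceleration to be piecewise continuous. *)
Record trajectory (a b : R) (n : nat) := Trajectory {
  position :> R -> 'cV[R]_n;
  velocity : R -> 'cV[R]_n;
  acceleration : R -> 'cV[R]_n;
  velocityP : is_D a b position velocity;
  accelerationP : is_D a b velocity acceleration }.

Definition integrand (n : nat) : Type :=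
  R -> 'cV[R]_n -> 'cV[R]_n -> 'cV[R]_n -> R.

Definition grad n (F : 'cV[R]_n -> R) (x : 'cV[R]_n) : 'cV[R]_n :=
  \col_j 'D_(delta_mx j 0) F x.

Definition grad_x n (phi : integrand n) t x v w : 'cV[R]_n :=
  grad (fun x' => phi t x' v w) x.
Definition grad_v n (phi : integrand n) t x v w : 'cV[R]_n :=
  grad (fun v' => phi t x v' w) v.
Definition grad_w n (phi : integrand n) t x v w : 'cV[R]_n :=
  grad (fun w' => phi t x v w') w.

Definition jointly_continuous n (W : normedModType R) (a b : R)
    (F : R -> 'cV[R]_n -> 'cV[R]_n -> 'cV[R]_n -> W) :=
  {within [set q : R * 'cV[R]_n * 'cV[R]_n * 'cV[R]_n |
             q.1.1.1 \in `[a, b]],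
   continuous (fun q : R * 'cV[R]_n * 'cV[R]_n * 'cV[R]_n =>
                 F q.1.1.1 q.1.1.2 q.1.2 q.2)}.

(* Continuous differentiability on [a, b] x R^n x R^n x R^n: all the partial
   derivatives exist and are jointly continuous, the one in t being one-sided
   at a and b. *)
Definition C1_integrand n (a b : R) (phi : integrand n) :=
  [/\ jointly_continuous a b phi,
      exists2 phit : integrand n, jointly_continuous a b phit &
        forall t x v w, t \in `[a, b] ->
          (phi s x v w - phi t x v w) / (s - t)
            @[s --> within (fun s => s \in `[a, b]) t^'] --> phit t x v w,
      forall t x v w (j : 'I_n), t \in `[a, b] ->
        [/\ derivable (fun x' => phi t x' v w) x (delta_mx j 0),
            derivable (fun v' => phi t x v' w) v (delta_mx j 0)
          & derivable (fun w' => phi t x v w') w (delta_mx j 0)]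
    & [/\ jointly_continuous a b (grad_x phi),
          jointly_continuous a b (grad_v phi)
        & jointly_continuous a b (grad_w phi)]].

Definition along n (a b : R) (W : Type)
    (F : R -> 'cV[R]_n -> 'cV[R]_n -> 'cV[R]_n -> W)
    (X : trajectory a b n) (t : R) : W :=
  F t (position X t) (velocity X t) (acceleration X t).

Definition functional n (a b : R) (phi : integrand n)
    (X : trajectory a b n) : R :=
  integ a b (along phi X).

(* Here the trajectory H is t |-> eta(t, x(t), u(t)) with its D and D^2. *)
Definition Delta n (a b : R) (phi : integrand n) (H U : trajectory a b n) : R :=
  integ a b (fun t => dotv (position H t) (along (grad_x phi) U t)
                    + dotv (velocity H t) (along (grad_v phi) U t)
                    + dotv (acceleration H t) (along (grad_w phi) U t)).

Definition pseudoinvex_at n (a b : R) (phi : integrand n)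
    (H X U : trajectory a b n) :=
  0 <= Delta phi H U -> functional phi U <= functional phi X.

Definition quasiinvex_at n (a b : R) (phi : integrand n)
    (H X U : trajectory a b n) :=
  functional phi X <= functional phi U -> Delta phi H U <= 0.

(* D eta and D^2 eta along (x, u) are well defined, and given by H, with
   eta = 0 wherever x = u and D eta = 0 wherever x' = u'. *)
Definition eta_trajectory n (a b : R)
    (eta : R -> 'cV[R]_n -> 'cV[R]_n -> 'cV[R]_n)
    (X U H : trajectory a b n) :=
  [/\ forall t, t \in `[a, b] ->
        position H t = eta t (position X t) (position U t),
      forall t, t \in `[a, b] -> position X t = position U t -> position H t = 0
    & forall t, t \in `[a, b] ->
        velocity X t = velocity U t -> velocity H t = 0].

Section Problems.
Variables (a b : R) (n p m r : nat).
Variables (f : 'I_p -> integrand n) (g : 'I_m -> integrand n).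
Variables (B : 'I_p -> R -> 'M[R]_n) (J : 'I_r.+1 -> {set 'I_m}).

Definition clamped (X : trajectory a b n) :=
  [/\ position X a = 0, position X b = 0, velocity X a = 0 & velocity X b = 0].

Definition VP_feasible (X : trajectory a b n) :=
  clamped X /\ forall t (j : 'I_m), t \in `[a, b] -> along (g j) X t <= 0.

Definition VP_objective (X : trajectory a b n) (i : 'I_p) : R :=
  integ a b (fun t => along (f i) X t
                    + Num.sqrt (dotv (position X t) (B i t *m position X t))).

(* lambda^T f_* + y^T g_*, where * is x, v or w according to G *)
Definition lagr_grad
    (G : integrand n -> R -> 'cV[R]_n -> 'cV[R]_n -> 'cV[R]_n -> 'cV[R]_n)
    (U : trajectory a b n) (y : R -> 'cV[R]_m) (lam : 'cV[R]_p) (t : R)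
    : 'cV[R]_n :=
  \sum_i lam i 0 *: along (G (f i)) U t + \sum_j y t j 0 *: along (G (g j)) U t.

Definition MixD_feasible (U : trajectory a b n) (y : R -> 'cV[R]_m)
    (z : 'I_p -> R -> 'cV[R]_n) (lam : 'cV[R]_p) :=
  (* y and z need only make all the integrals involved meaningful *)
  [/\ forall j, lebesgue_measure.-integrable `[a, b] (fun t => (y t j 0)%:E)
    & forall i k, measurable_fun `[a, b] (fun t => z i t k 0)] /\
  [/\ clamped U,
      exists P1 Q1 Q2 : R -> 'cV[R]_n,
        [/\ is_D a b (lagr_grad (@grad_v n) U y lam) P1,
            is_D a b (lagr_grad (@grad_w n) U y lam) Q1,
            is_D a b Q1 Q2
          & forall t, t \in `[a, b] ->
              \sum_i lam i 0 *:
                (along (grad_x (f i)) U t + B i t *m z i t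
                 + \sum_j y t j 0 *: along (grad_x (g j)) U t)
              - P1 t + Q2 t = 0],
      forall al : 'I_r.+1, (0 < al)%N ->
        0 <= \sum_(j in J al) integ a b (fun t => y t j 0 * along (g j) U t),
      forall i t, t \in `[a, b] -> dotv (z i t) (B i t *m z i t) <= 1
    & forall t j, t \in `[a, b] -> 0 <= y t j 0] /\
  [/\ forall i, 0 < lam i 0 & \sum_i lam i 0 = 1].

Definition MixD_objective (U : trajectory a b n) (y : R -> 'cV[R]_m)
    (z : 'I_p -> R -> 'cV[R]_n) (i : 'I_p) : R :=
  integ a b (fun t => along (f i) U t + dotv (position U t) (B i t *m z i t)
                    + \sum_(j in J ord0) y t j 0 * along (g j) U t).

(* Integrands, as functions of (t, x, x', x'') with y, z, lambda held fixed, of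
   the functionals that are assumed pseudoinvex and quasi-invex. *)
Definition phi0 (y : R -> 'cV[R]_m) (z : 'I_p -> R -> 'cV[R]_n)
    (lam : 'cV[R]_p) : integrand n :=
  fun t x v w => \sum_i lam i 0 *
    (f i t x v w + \sum_(j in J ord0) y t j 0 * g j t x v w
     + dotv x (B i t *m z i t)).

Definition phi_block (y : R -> 'cV[R]_m) (al : 'I_r.+1) : integrand n :=
  fun t x v w => \sum_(j in J al) y t j 0 * g j t x v w.

End Problems.
End Defs.

(* Main.v *)
Require Import Defs.
From HB Require Import structures.
From mathcomp Require Import all_boot all_order all_algebra.
From mathcomp Require Import all_classical all_reals all_analysis.
From mathcomp Require Import measurable_realfun.
From mathcomp Require Import ring lra.
Set Implicit Arguments.
Unset Strict Implicit.
Unset Printing Implicit Defensive.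
Import Order.TTheory GRing.Theory Num.Theory.
Import numFieldNormedType.Exports.
Local Open Scope classical_set_scope.
Local Open Scope ring_scope.

(** Weak duality rests on one identity: along any eta-trajectory H, the first
    variations at U of the functionals assumed pseudoinvex and quasi-invex add
    up to zero ([sum_Delta_eq0]).  Indeed, since the multipliers lambda sum to 1
    and the J_alpha partition the constraints, these functionals add up to the
    integral of the full Lagrangian, whose Euler-Poisson equation

      L_x - D L_v + D^2 L_w = 0

    is the dual constraint.  Substituting it, the sum of the variations becomes
    the integral of an exact derivative,

      H.(D L_v - D^2 L_w) + H'.L_v + H''.L_w
        = d/dt [ H.(L_v - D L_w) + H'.L_w ],

    and the bracket vanishes at both ends because x and u, hence also H and H',
    satisfy the same boundary conditions.

    For alpha >= 1, primal feasibility gives Phi_alpha(x) <= 0 and dual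
    feasibility gives 0 <= Phi_alpha(u), so quasi-invexity makes the variation
    of Phi_alpha nonpositive.  By the identity the variation of Phi_0 is
    nonnegative, and pseudoinvexity gives Phi_0(u) <= Phi_0(x).

    Finally Phi_0 is at every trajectory the lambda-weighted sum of the dual
    objectives ([functional_phi0]), and at the feasible x each dual objective is
    at most the primal one ([MixD_objective_le_VP]), by y.g <= 0 and by the
    Cauchy-Schwarz inequality x.Bz <= sqrt(x.Bx) sqrt(z.Bz) <= sqrt(x.Bx).  As
    every lambda_i is positive, (i) and (ii) would give Phi_0(x) < Phi_0(u).

    The rest is analysis.  Accelerations are only piecewise continuous, so one
    needs that piecewise continuous functions are stable under composition,
    bounded and measurable, and a fundamental theorem of calculus in which the
    derivative may fail at finitely many points ([ftc_off_finite]).  The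
    multipliers y are merely integrable and the z_i merely measurable; the
    integrands containing them are integrable because y is multiplied by
    bounded functions and x.Bz is bounded by sqrt(x.Bx). *)

(** * Piecewise continuous functions *)

Section PiecewiseContinuous.
Context {R : realType}.
Implicit Types (a b : R) (W : normedModType R).

(** One-sided limits of v stay in A because A is closed, so F is continuous
    there relative to A.  The relative version is what integrands that are
    continuous only for times in [a, b] call for. *)
Lemma piecewise_continuous_comp W W' (A : set W) (F : W -> W') a b
    (v : R -> W) :
  closed A -> {within A, continuous F} ->
  (forall t, t \in `[a, b] -> A (v t)) ->
  piecewise_continuous a b v -> piecewise_continuous a b (F \o v).
Proof.
move=> clA /subspace_continuousP cF Av [[S cv] rv lv].
(* Off [a, b] the values of v are free, so A only eventually contains v. *)
have lim_comp (P : set_system R) l : ProperFilter P -> v @ P --> l ->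
    (\forall s \near P, A (v s)) -> A l -> F \o v @ P --> F l.
  move=> PP vl AP Al; apply: cvg_trans (cF l Al) => U /= UF.
  have vlU : P (fun s => A (v s) -> U (F (v s))) := vl _ UF.
  by apply: filterS2 vlU AP => s; exact.
have lim_in (P : set_system R) l : ProperFilter P -> v @ P --> l ->
    (\forall s \near P, A (v s)) -> A l.
  by move=> PP vl AP; exact: (@closed_cvg _ _ P PP v A clA AP l vl).
split.
- exists S => t tab tS; apply: (lim_comp _ _ _ (cv _ tab tS)).
    near=> s; apply: Av; near: s.
    have := near_in_itvoo tab; apply: filterS => s; exact: subset_itv_oo_cc.
  by apply: Av; exact: subset_itv_oo_cc.
- move=> t tab; have vr := rv _ tab.
  have Ar : \forall s \near t^'+, A (v s).
    have /andP[at_ tb] : (a <= t < b) by rewrite in_itv in tab.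
    near=> s; apply: Av; rewrite in_itv/=; apply/andP; split.
      by apply: (le_trans at_); near: s; exact: nbhs_right_ge.
    by near: s; exact: nbhs_right_le.
  by apply: cvgP (lim_comp _ _ _ vr Ar (lim_in _ _ _ vr Ar)).
- move=> t tab; have vr := lv _ tab.
  have Ar : \forall s \near t^'-, A (v s).
    have /andP[at_ tb] : (a < t <= b) by rewrite in_itv in tab.
    near=> s; apply: Av; rewrite in_itv/=; apply/andP; split.
      by near: s; exact: nbhs_left_ge.
    by apply: le_trans tb; near: s; exact: nbhs_left_le.
  by apply: cvgP (lim_comp _ _ _ vr Ar (lim_in _ _ _ vr Ar)).
Unshelve. all: by end_near. Qed.

Lemma piecewise_continuous_comp_cont W W' (F : W -> W') a b (v : R -> W) :
  continuous F -> piecewise_continuous a b v ->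
  piecewise_continuous a b (F \o v).
Proof.
move=> cF; apply: (@piecewise_continuous_comp _ _ setT) => //.
by apply: continuous_subspaceT.
Qed.

Lemma piecewise_continuous_pair W W' a b (v : R -> W) (w : R -> W') :
  piecewise_continuous a b v -> piecewise_continuous a b w ->
  piecewise_continuous a b (fun t => (v t, w t)).
Proof.
move=> [[S cv] rv lv] [[S' cw] rw lw]; split.
- exists (S ++ S') => t tab; rewrite mem_cat negb_or => /andP[tS tS'].
  by apply: cvg_pair; [exact: cv|exact: cw].
- move=> t tab; apply/cvg_ex; exists (lim (v @ t^'+), lim (w @ t^'+)).
  exact: cvg_pair (rv _ tab) (rw _ tab).
- move=> t tab; apply/cvg_ex; exists (lim (v @ t^'-), lim (w @ t^'-)).
  exact: cvg_pair (lv _ tab) (lw _ tab).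
Qed.

Lemma within_continuous_piecewise W a b (v : R -> W) : a < b ->
  {within `[a, b], continuous v} -> piecewise_continuous a b v.
Proof.
move=> ab cv; split.
- exists [::] => t tab _; have := cv.
  move=> /(continuous_subspaceW (@subset_itv_oo_cc _ _ a b)).
  by rewrite continuous_open_subspace//; apply; rewrite inE.
- move=> t; rewrite in_itv/= => /andP[at_ tb]; apply: (cvgP (v t)).
  move/subspace_continuousP : cv => /(_ t).
  rewrite /= in_itv/= at_ (ltW tb) => /(_ isT); apply: cvg_trans.
  apply: cvg_app => U; rewrite /at_right !nbhs_simpl /within/= => H.
  near=> s => ts; apply: (near H s) => //.
  rewrite in_itv/= (le_trans at_ (ltW ts))/=; apply/ltW; near: s.
  exact: lt_nbhsl.
- move=> t; rewrite in_itv/= => /andP[at_ tb]; apply: (cvgP (v t)).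
  move/subspace_continuousP : cv => /(_ t).
  rewrite /= in_itv/= tb (ltW at_) => /(_ isT); apply: cvg_trans.
  apply: cvg_app => U; rewrite /at_left !nbhs_simpl /within/= => H.
  near=> s => ts; apply: (near H s) => //.
  rewrite in_itv/= (le_trans (ltW ts) tb) andbT; apply/ltW; near: s.
  exact: lt_nbhsr.
Unshelve. all: by end_near. Qed.

Lemma piecewise_continuousD a b (h k : R -> R) :
  piecewise_continuous a b h -> piecewise_continuous a b k ->
  piecewise_continuous a b (fun t => h t + k t).
Proof.
move=> ch ck; have := piecewise_continuous_pair ch ck.
apply: (piecewise_continuous_comp_cont (F := fun q : R * R => q.1 + q.2)).
exact: add_continuous.
Qed.

Lemma piecewise_continuousM a b (h k : R -> R) :
  piecewise_continuous a b h -> piecewise_continuous a b k ->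
  piecewise_continuous a b (fun t => h t * k t).
Proof.
move=> ch ck; have := piecewise_continuous_pair ch ck.
apply: (piecewise_continuous_comp_cont (F := fun q : R * R => q.1 * q.2)).
exact: mul_continuous.
Qed.

Lemma piecewise_continuous_cst a b (c : R) :
  piecewise_continuous a b (fun=> c).
Proof.
split; first by exists [::] => t _ _; exact: cvg_cst.
- by move=> t _; exact: is_cvg_cst.
- by move=> t _; exact: is_cvg_cst.
Qed.

Lemma piecewise_continuous_coord n a b (v : R -> 'cV[R]_n) i :
  piecewise_continuous a b v -> piecewise_continuous a b (fun t => v t i 0).
Proof.
apply: (@piecewise_continuous_comp_cont _ _ (fun u : 'cV[R]_n => u i 0)).
exact: coord_continuous.
Qed.

Lemma piecewise_continuous_sum (I : Type) (s : seq I) (P : pred I) a b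
    (h : I -> R -> R) :
  (forall i, piecewise_continuous a b (h i)) ->
  piecewise_continuous a b (fun t => \sum_(i <- s | P i) h i t).
Proof.
move=> ch; elim: s => [|i s IH].
  under eq_fun do rewrite big_nil.
  exact: piecewise_continuous_cst.
under eq_fun do rewrite big_cons.
by case: (P i) => //; exact: piecewise_continuousD.
Qed.

(** Near each point v is bounded on either side by its one-sided limits, and at
    the point itself by its value; compactness makes the bound uniform. *)
Lemma piecewise_continuous_bounded W a b (v : R -> W) :
  piecewise_continuous a b v -> [bounded v t | t in `[a, b]].
Proof.
move=> [_ rv lv].
have one_sided (P : set_system R) : Filter P -> cvg (v @ P) ->
    exists K, \forall s \near P, `|v s| <= K.
  move=> PP /cvgrPdist_lt/(_ _ ltr01) vP; exists (`|lim (v @ P)| + 1).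
  near=> s; rewrite -lerBlDl; apply: (le_trans (lerB_dist _ _)).
  by rewrite distrC; apply/ltW; near: s.
have ncw : near_covering_within (`[a, b]%classic : set R).
  by apply/near_covering_withinP/compact_near_coveringP/segment_compact.
apply: (ncw _ _ (fun M t => `|v t| <= M)).
move=> t; rewrite /= in_itv/= => /andP[at_ tb].
have [Kr Hr] : exists K, \forall s \near t, t < s -> s \in `[a, b] -> `|v s| <= K.
  have [tb'|tb'] := ltP t b.
    have [|K HK] := one_sided t^'+ _; first by apply: rv; rewrite in_itv/= at_.
    by exists K; move: HK; apply: filterS => s /[swap] _; exact.
  exists 0; near=> s => ts; rewrite in_itv/= => /andP[_ sb].
  by have := lt_le_trans ts (le_trans sb tb'); rewrite ltxx.
have [Kl Hl] : exists K, \forall s \near t, s < t -> s \in `[a, b] -> `|v s| <= K.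
  have [at'|at'] := ltP a t.
    have [|K HK] := one_sided t^'- _; first by apply: lv; rewrite in_itv/= at'.
    by exists K; move: HK; apply: filterS => s /[swap] _; exact.
  exists 0; near=> s => ts; rewrite in_itv/= => /andP[as_ _].
  by have := le_lt_trans (le_trans at' as_) ts; rewrite ltxx.
pose K := `|v t| + `|Kr| + `|Kl|.
near=> s M => /= sab.
apply: (@le_trans _ _ K); last by near: M; apply: nbhs_pinfty_ge; exact: num_real.
have [st|ts|->] := ltgtP s t.
- have /le_trans : `|v s| <= Kl by apply: (near Hl s).
  by apply; rewrite /K ler_wpDl// ler_norm.
- have /le_trans : `|v s| <= Kr by apply: (near Hr s).
  by apply; rewrite /K addrAC ler_wpDl// ler_norm.
- by rewrite /K -addrA lerDl addr_ge0.
Unshelve. all: by end_near. Qed.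

(** Off a finite set E, which contains the end points, h is continuous on an
    open set; on E every preimage is finite. *)
Lemma piecewise_continuous_measurable a b (h : R -> R) :
  piecewise_continuous a b h -> measurable_fun `[a, b] h.
Proof.
move=> [[S ch] _ _].
pose E : set R := [set` a :: b :: S].
have fE : finite_set E by exact: finite_seq.
have mcount (D : set R) : D `<=` E -> measurable D.
  move=> DE; apply: countable_measurable; first by move=> ?; exact: measurable_set1.
  by apply: finite_set_countable; exact: sub_finite_set fE.
have -> : `[a, b]%classic = (`]a, b[%classic `\` E) `|` (`[a, b]%classic `&` E).
  apply/seteqP; split => [t tab|t [[/subset_itv_oo_cc//]|[]//]].
  have [tE|tE] := pselect (E t); [by right|left; split => //].
  move: tE => /= /negP; rewrite !inE !negb_or => /and3P[ta tb _].
  have : t \in `]a, b[; last by [].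
  by move: tab; rewrite /= !in_itv/= !lt_neqAle eq_sym ta tb.
have oO : open (`]a, b[%classic `\` E).
  rewrite setDE; apply: openI; first exact: interval_open.
  rewrite openC; apply: (accessible_finite_set_closed.1 _ _ fE).
  exact/hausdorff_accessible/Rhausdorff.
apply/measurable_funU; [exact: open_measurable|by apply: mcount => t []|split].
- apply: open_continuous_measurable_fun => // t; rewrite inE => -[tab tE].
  by apply: ch => //; apply/negP => tS; apply: tE; rewrite /E /= !inE tS !orbT.
- by move=> _ Y mY; apply: mcount => t [[_]].
Qed.

Lemma piecewise_continuousS W a b c d (v : R -> W) : a <= c -> d <= b ->
  piecewise_continuous a b v -> piecewise_continuous c d v.
Proof.
move=> ac db [[S cv] rv lv]; split.
- by exists S => t tcd; apply: cv; apply: subset_itv tcd; rewrite bnd_simp.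
- by move=> t tcd; apply: rv; apply: subset_itv tcd; rewrite bnd_simp.
- by move=> t tcd; apply: lv; apply: subset_itv tcd; rewrite bnd_simp.
Qed.

Local Notation mu := (@lebesgue_measure R).

Lemma piecewise_continuous_integrable a b (h : R -> R) :
  piecewise_continuous a b h -> mu.-integrable `[a, b] (EFin \o h).
Proof.
move=> ch; apply: measurable_bounded_integrable => //.
- by rewrite /= lebesgue_measure_itv/=; case: ifP => _; rewrite ?ltry.
- exact: piecewise_continuous_measurable.
- exact: piecewise_continuous_bounded.
Qed.

Lemma integrable_mul_piecewise_continuous a b (y h : R -> R) :
  mu.-integrable `[a, b] (EFin \o y) -> piecewise_continuous a b h ->
  mu.-integrable `[a, b] (EFin \o (fun t => y t * h t)).
Proof.
move=> iy ch; apply: (integrableMl _ iy) => //.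
- exact: piecewise_continuous_measurable.
- exact: piecewise_continuous_bounded.
Qed.

(** * A fundamental theorem of calculus off a finite set *)

Lemma ftc_continuous a b (F h : R -> R) : a < b ->
  {within `[a, b], continuous F} -> piecewise_continuous a b h ->
  (forall t, t \in `]a, b[ ->
    {for t, continuous h} /\ is_derive t (1 : R) F (h t)) ->
  integ a b h = F b - F a.
Proof.
move=> ab cF ch dF; have [_ rh lh] := ch.
(* The values of h at a and b are free: k replaces them by the limits. *)
pose k t := if t == a then lim (h @ a^'+) else
            if t == b then lim (h @ b^'-) else h t.
have kh t : t \in `]a, b[ -> k t = h t.
  by rewrite in_itv/= /k => /andP[at_ tb]; rewrite gt_eqF// lt_eqF.
have ck : {within `[a, b], continuous k}.
  apply/continuous_within_itvP => //; split.
  - move=> t tab; rewrite /continuous_at kh//.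
    apply: cvg_trans (dF _ tab).1; apply: near_eq_cvg; near=> s; rewrite kh//.
    by near: s; exact: near_in_itvoo.
  - rewrite [k a]/k eqxx; have : cvg (h @ a^'+) by apply: rh; rewrite in_itv/= lexx.
    apply: cvg_trans; apply: near_eq_cvg; near=> s; rewrite kh// in_itv/=.
    by apply/andP; split; near: s; [exact: nbhs_right_gt|exact: nbhs_right_lt].
  - rewrite [k b]/k eqxx gt_eqF//.
    have : cvg (h @ b^'-) by apply: lh; rewrite in_itv/= lexx andbT.
    apply: cvg_trans; apply: near_eq_cvg; near=> s; rewrite kh// in_itv/=.
    by apply/andP; split; near: s; [exact: nbhs_left_gt|exact: nbhs_left_lt].
have -> : integ a b h = integ a b k.
  have ioo (g : R -> R) : mu.-integrable `[a, b] (EFin \o g) ->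
      integ a b g = \int[mu]_(t in `]a, b[) g t.
    move=> ig; rewrite /integ -Rintegral_itv_obnd_cbnd.
      rewrite -Rintegral_itv_bndo_bndc//.
      by apply: integrableS ig => //; exact: subset_itv_oo_cc.
    by apply: integrableS ig => //; exact: subset_itv_oc_cc.
  rewrite ioo; last exact: piecewise_continuous_integrable.
  rewrite ioo; last exact/piecewise_continuous_integrable/within_continuous_piecewise.
  by apply: eq_Rintegral => t; rewrite inE => /kh.
rewrite /integ /Rintegral (continuous_FTC2 ab ck (F := F))//.
- have [_ Fa Fb] := (continuous_within_itvP _ ab).1 cF.
  by split => // t /dF[_ []].
- move=> t tab; rewrite kh// derive1E; have [_ [_ ->]] := dF _ tab; exact: erefl.
Unshelve. all: by end_near. Qed.

(** Unlike [is_D], this allows finitely many unspecified exceptions, even where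
    h happens to be continuous.  This makes it stable under sums and products:
    a combination of discontinuous derivatives can be continuous by accident. *)
Definition primitive_off_finite a b (F h : R -> R) :=
  [/\ {within `[a, b], continuous F}, piecewise_continuous a b h
    & exists S : seq R, forall t, t \in `]a, b[ -> t \notin S ->
        is_derive t (1 : R) F (h t)].

(** Induction on the list of exceptional points: one lying inside the interval
    splits it in two, and the continuity of F glues the two halves. *)
Lemma ftc_off_finite a b (F h : R -> R) : a < b ->
  primitive_off_finite a b F h -> integ a b h = F b - F a.
Proof.
move=> ab [cF ch [S' dF]]; have [[S hc] _ _] := ch.
have {hc dF S S'} [S] : exists S : seq R, forall t, t \in `]a, b[ -> t \notin S ->
    {for t, continuous h} /\ is_derive t (1 : R) F (h t).
  exists (S ++ S') => t tab; rewrite mem_cat negb_or => /andP[tS tS'].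
  by split; [exact: hc|exact: dF].
elim: S a b ab cF ch => [|s S IH] a b ab cF ch dF.
  by apply: ftc_continuous => // t tab; apply: dF.
have [sab|sab] := boolP (s \in `]a, b[); last first.
  apply: IH => // t tab tS; apply: dF => //; rewrite inE negb_or tS andbT.
  by apply: contraNneq sab => <-.
have := sab; rewrite in_itv/= => /andP[as_ sb].
have asab : `[a, s] `<=` `[a, b]%classic by apply: subset_itvl; rewrite bnd_simp ltW.
have sbab : `[s, b] `<=` `[a, b]%classic by apply: subset_itvr; rewrite bnd_simp ltW.
have E1 : integ a s h = F s - F a.
  apply: IH => //; first exact: continuous_subspaceW cF.
    by apply: piecewise_continuousS ch => //; exact: ltW.
  move=> t; rewrite in_itv/= => /andP[at_ ts] tS; apply: dF.
    by rewrite in_itv/= at_ (lt_trans ts).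
  by rewrite inE negb_or tS lt_eqF.
have E2 : integ s b h = F b - F s.
  apply: IH => //; first exact: continuous_subspaceW cF.
    by apply: piecewise_continuousS ch => //; exact: ltW.
  move=> t; rewrite in_itv/= => /andP[st tb] tS; apply: dF.
    by rewrite in_itv/= tb (lt_trans as_).
  by rewrite inE negb_or tS gt_eqF.
have ih := piecewise_continuous_integrable ch.
have -> : integ a b h = integ a s h + integ s b h.
  rewrite {3}/integ -Rintegral_itv_obnd_cbnd.
    by rewrite -(Rintegral_itvB ih) ?bnd_simp ?ltW// addrC subrK.
  by apply: integrableS ih => // t; apply: subset_itv; rewrite bnd_simp// ltW.
by rewrite E1 E2 addrC subrKA.
Qed.

Lemma primitive_off_finiteD a b (F G h k : R -> R) :
  primitive_off_finite a b F h -> primitive_off_finite a b G k ->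
  primitive_off_finite a b (fun t => F t + G t) (fun t => h t + k t).
Proof.
move=> [cF ch [S dF]] [cG ck [S' dG]]; split.
- by move=> t; apply: cvgD; [exact: cF|exact: cG].
- exact: piecewise_continuousD.
- exists (S ++ S') => t tab; rewrite mem_cat negb_or => /andP[tS tS'].
  by have /= := dF t tab tS; have /= := dG t tab tS'; move=> ? ?; exact: is_deriveD.
Qed.

Lemma primitive_off_finiteM a b (F G h k : R -> R) : a < b ->
  primitive_off_finite a b F h -> primitive_off_finite a b G k ->
  primitive_off_finite a b (fun t => F t * G t)
                           (fun t => h t * G t + F t * k t).
Proof.
move=> ab [cF ch [S dF]] [cG ck [S' dG]]; split.
- by move=> t; apply: cvgM; [exact: cF|exact: cG].
- apply: piecewise_continuousD; apply: piecewise_continuousM => //.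
    exact: within_continuous_piecewise.
  exact: within_continuous_piecewise.
- exists (S ++ S') => t tab; rewrite mem_cat negb_or => /andP[tS tS'].
  have /= dFt := dF t tab tS; have /= dGt := dG t tab tS'.
  have /is_derive_eq : is_derive t 1 (F * G) (F t *: k t + G t *: h t).
    exact: is_deriveM.
  by apply; rewrite /GRing.scale/= addrC (mulrC (G t)).
Qed.

Lemma primitive_off_finite_cst a b (c : R) :
  primitive_off_finite a b (fun=> c) (fun=> 0).
Proof.
split; first by move=> t; exact: cvg_cst.
- exact: piecewise_continuous_cst.
- by exists [::] => t _ _; exact: is_derive_cst.
Qed.

Lemma primitive_off_finite_sum (I : Type) (s : seq I) a b (F h : I -> R -> R) :
  (forall i, primitive_off_finite a b (F i) (h i)) ->
  primitive_off_finite a b (fun t => \sum_(i <- s) F i t)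
                           (fun t => \sum_(i <- s) h i t).
Proof.
move=> H; elim: s => [|i s IH].
  under eq_fun do rewrite big_nil.
  under [X in primitive_off_finite _ _ _ X]eq_fun do rewrite big_nil.
  exact: primitive_off_finite_cst.
under eq_fun do rewrite big_cons.
under [X in primitive_off_finite _ _ _ X]eq_fun do rewrite big_cons.
exact: primitive_off_finiteD.
Qed.

Lemma is_D_coord n a b (w v : R -> 'cV[R]_n) i :
  is_D a b w v ->
  primitive_off_finite a b (fun t => w t i 0) (fun t => v t i 0).
Proof.
move=> [cw cv dw]; split.
- move=> t; apply: (cvg_comp _ (fun u : 'cV[R]_n => u i 0) (cw t)).
  exact: coord_continuous.
- exact: piecewise_continuous_coord.
- have [[S vc] _ _] := cv; exists S => t tab tS.
  have [dwt <-] := dw t tab (vc t tab tS).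
  split; first by move/derivable_mxP : dwt.
  by rewrite derive_mx// mxE.
Qed.

End PiecewiseContinuous.

(** * Dot products, gradients and integrals *)

Section DotProduct.
Context {R : realType}.
Implicit Types n : nat.

Lemma dotvE n (u v : 'cV[R]_n) : dotv u v = \sum_k u k 0 * v k 0.
Proof. by rewrite /dotv mxE; apply: eq_bigr => k _; rewrite mxE. Qed.

Lemma dotvDl n (u v w : 'cV[R]_n) : dotv (u + v) w = dotv u w + dotv v w.
Proof. by rewrite /dotv linearD/= mulmxDl mxE. Qed.

Lemma dotvDr n (u v w : 'cV[R]_n) : dotv u (v + w) = dotv u v + dotv u w.
Proof. by rewrite /dotv mulmxDr mxE. Qed.

Lemma dotvZl n c (u v : 'cV[R]_n) : dotv (c *: u) v = c * dotv u v.
Proof. by rewrite /dotv linearZ/= -scalemxAl mxE. Qed.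

Lemma dotvZr n c (u v : 'cV[R]_n) : dotv u (c *: v) = c * dotv u v.
Proof. by rewrite /dotv -scalemxAr mxE. Qed.

Lemma dotv_sumr n (I : finType) (P : pred I) (u : 'cV[R]_n) (v : I -> 'cV[R]_n) :
  dotv u (\sum_(i | P i) v i) = \sum_(i | P i) dotv u (v i).
Proof. by rewrite /dotv mulmx_sumr summxE. Qed.

(** The discriminant argument in a single evaluation: with c = x.Az, the form is
    nonnegative at x - c z, that is x.Ax - 2 c^2 + c^2 z.Az >= 0, and z.Az <= 1. *)
Lemma psd_cauchy_schwarz n (A : 'M[R]_n) (x z : 'cV[R]_n) : A^T = A ->
  (forall v : 'cV[R]_n, 0 <= dotv v (A *m v)) -> dotv z (A *m z) <= 1 ->
  `|dotv x (A *m z)| <= Num.sqrt (dotv x (A *m x)).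
Proof.
move=> symA psdA z1; set c := dotv x (A *m z).
have czx : dotv z (A *m x) = c.
  rewrite /c /dotv; transitivity (((z^T *m (A *m x))^T) 0 0); first by rewrite [RHS]mxE.
  by rewrite !trmx_mul trmxK symA -mulmxA.
rewrite -sqrtr_sqr ler_sqrt//.
have := psdA (x + (- c) *: z).
rewrite mulmxDr -scalemxAr !dotvDl !dotvDr !dotvZl !dotvZr czx -/c => H.
suff : c ^+ 2 * dotv z (A *m z) <= c ^+ 2 by move: H; rewrite expr2; lra.
by rewrite ler_piMr ?sqr_ge0.
Qed.

Lemma piecewise_continuous_dotv n a b (u v : R -> 'cV[R]_n) :
  piecewise_continuous a b u -> piecewise_continuous a b v ->
  piecewise_continuous a b (fun t => dotv (u t) (v t)).
Proof.
move=> cu cv; under eq_fun do rewrite dotvE.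
apply: piecewise_continuous_sum => k; apply: piecewise_continuousM;
  exact: piecewise_continuous_coord.
Qed.

End DotProduct.

Section Gradient.
Context {R : realType} {n : nat}.
Implicit Types (F : 'cV[R]_n -> R) (x : 'cV[R]_n).

Definition has_partials F x :=
  forall j : 'I_n, derivable F x (delta_mx j 0).

Lemma has_partialsD F G x : has_partials F x -> has_partials G x ->
  has_partials (fun x' => F x' + G x') x.
Proof. by move=> dF dG j; exact: derivableD. Qed.

Lemma gradD F G x : has_partials F x -> has_partials G x ->
  grad (fun x' => F x' + G x') x = grad F x + grad G x.
Proof.
move=> dF dG; apply/matrixP => j k; rewrite !mxE.
exact: deriveD.
Qed.

Lemma has_partialsZ (c : R) F x : has_partials F x ->
  has_partials (fun x' => c * F x') x.
Proof. by move=> dF j; exact: derivableZ. Qed.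

Lemma gradZ (c : R) F x : has_partials F x ->
  grad (fun x' => c * F x') x = c *: grad F x.
Proof.
move=> dF; apply/matrixP => j k; rewrite !mxE.
exact: deriveZ.
Qed.

Lemma has_partials_cst (c : R) x : has_partials (fun=> c) x.
Proof. by move=> j; exact: derivable_cst. Qed.

Lemma grad_cst (c : R) x : grad (fun=> c) x = 0.
Proof. by apply/matrixP => j k; rewrite !mxE derive_cst. Qed.

Lemma grad_sum (I : Type) (s : seq I) (P : pred I) (F : I -> 'cV[R]_n -> R) x :
  (forall i, has_partials (F i) x) ->
  has_partials (fun x' => \sum_(i <- s | P i) F i x') x /\
  grad (fun x' => \sum_(i <- s | P i) F i x') x = \sum_(i <- s | P i) grad (F i) x.
Proof.
move=> dF; elim: s => [|i s [dS gS]].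
  under eq_fun do rewrite big_nil.
  by rewrite big_nil grad_cst; split => //; exact: has_partials_cst.
under eq_fun do rewrite big_cons.
rewrite big_cons; case: (P i) => //; split; first exact: has_partialsD.
by rewrite gradD// gS.
Qed.

Lemma is_derive_dotv (c x v : 'cV[R]_n) :
  is_derive x v (fun x' => dotv x' c) (dotv v c).
Proof.
pose q h := h^-1 *: (dotv (h *: v + x) c - dotv x c) : R.
have q_cst : {near 0^', cst (dotv v c) =1 q}.
  near=> h; rewrite /q dotvDl dotvZl addrK /GRing.scale/= mulrA mulVf ?mul1r//.
  by near: h; exact: nbhs_dnbhs_neq.
have H : q @ 0^' --> dotv v c.
  exact: cvg_trans (near_eq_cvg q_cst) (cvg_cst (dotv v c)).
by split; [exact: cvgP H|exact: cvg_lim H].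
Unshelve. all: by end_near. Qed.

Lemma has_partials_dotv (c x : 'cV[R]_n) : has_partials (fun x' => dotv x' c) x.
Proof. by move=> j; have [] := is_derive_dotv c x (delta_mx j 0). Qed.

Lemma grad_dotv (c x : 'cV[R]_n) : grad (fun x' => dotv x' c) x = c.
Proof.
apply/matrixP => j k; rewrite !mxE ord1.
have [_ ->] := is_derive_dotv c x (delta_mx j 0).
rewrite dotvE (bigD1 j)//= mxE !eqxx mul1r big1 ?addr0// => i ij.
by rewrite mxE (negbTE ij) mul0r.
Qed.

End Gradient.

Section Integral.
Context {R : realType} (a b : R).
Local Notation mu := (@lebesgue_measure R).
Local Notation integrable h := (mu.-integrable `[a, b] (EFin \o h)).

Lemma integ_eq (h k : R -> R) : (forall t, t \in `[a, b] -> h t = k t) ->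
  integ a b h = integ a b k.
Proof. by move=> hk; apply: eq_Rintegral => t; rewrite inE => /hk. Qed.

Lemma integrable_eq (h k : R -> R) : (forall t, t \in `[a, b] -> h t = k t) ->
  integrable h -> integrable k.
Proof.
move=> hk; apply: eq_integrable => // t; rewrite inE => /hk /= -> //.
Qed.

Lemma integrable_add (h k : R -> R) : integrable h -> integrable k ->
  integrable (fun t => h t + k t).
Proof. by move=> ih ik; apply: eq_integrable (integrableD _ ih ik). Qed.

Lemma integrable_scale c (h : R -> R) : integrable h ->
  integrable (fun t => c * h t).
Proof. by move=> ih; apply: eq_integrable (integrableZl _ c ih). Qed.

Lemma integ_sum (I : Type) (s : seq I) (P : pred I) (h : I -> R -> R) :
  (forall i, integrable (h i)) ->
  integrable (fun t => \sum_(i <- s | P i) h i t) /\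
  integ a b (fun t => \sum_(i <- s | P i) h i t) =
    \sum_(i <- s | P i) integ a b (h i).
Proof.
move=> ih; elim: s => [|i s [iS eS]].
  have -> : (fun t => \sum_(i <- [::] | P i) h i t) = cst 0.
    by apply/funext => t; rewrite big_nil.
  split; first exact: integrable0.
  by rewrite big_nil /integ Rintegral_cst// mul0r.
have -> : (fun t => \sum_(j <- i :: s | P j) h j t) =
    if P i then (fun t => h i t + \sum_(j <- s | P j) h j t)
    else (fun t => \sum_(j <- s | P j) h j t).
  by case: ifP => Pi; apply/funext => t; rewrite big_cons Pi.
rewrite big_cons; case: (P i) => //.
by split; [exact: integrable_add|rewrite -eS; exact: RintegralD].
Qed.

End Integral.

(** * Trajectories and first variations *)

Section Trajectories.
Context {R : realType} {n : nat} {a b : R}.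
Hypothesis lt_ab : a < b.
Implicit Types (X U H : trajectory a b n) (phi : integrand (R := R) n).
Local Notation mu := (@lebesgue_measure R).
Local Notation integrable h := (mu.-integrable `[a, b] (EFin \o h)).

Lemma piecewise_continuous_position X : piecewise_continuous a b (position X).
Proof. by apply: within_continuous_piecewise; have [] := velocityP X. Qed.

Lemma piecewise_continuous_velocity X : piecewise_continuous a b (velocity X).
Proof. by have [] := velocityP X. Qed.

Lemma piecewise_continuous_acceleration X :
  piecewise_continuous a b (acceleration X).
Proof. by have [] := accelerationP X. Qed.

Lemma piecewise_continuous_along (W : normedModType R)
    (F : R -> 'cV[R]_n -> 'cV[R]_n -> 'cV[R]_n -> W) X :
  jointly_continuous a b F -> piecewise_continuous a b (along F X).
Proof.
move=> cF.
pose q t := (t, position X t, velocity X t, acceleration X t).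
have cq : piecewise_continuous a b q.
  apply: piecewise_continuous_pair; last exact: piecewise_continuous_acceleration.
  apply: piecewise_continuous_pair; last exact: piecewise_continuous_velocity.
  apply: piecewise_continuous_pair; last exact: piecewise_continuous_position.
  apply: within_continuous_piecewise => //.
  by apply: continuous_subspaceT => t; exact: cvg_id.
apply: (piecewise_continuous_comp _ cF _ cq) => //.
have ctime : continuous
    (fun q : R * 'cV[R]_n * 'cV[R]_n * 'cV[R]_n => q.1.1.1).
  move=> p; apply: (@continuous_comp _ _ _ fst (fun r => r.1.1)).
    exact: cvg_fst.
  by apply: (@continuous_comp _ _ _ fst fst); exact: cvg_fst.
exact: (continuous_closedP _).1 ctime _ (@itv_closed _ _ a b).
Qed.

(** The integrand is the derivative of H.(LV - Q1) + H'.LW, which vanishes at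
    both ends. *)
Lemma by_parts_twice H (LV P1 LW Q1 Q2 : R -> 'cV[R]_n) :
  clamped H -> is_D a b LV P1 -> is_D a b LW Q1 -> is_D a b Q1 Q2 ->
  let h t := dotv (position H t) (P1 t - Q2 t) + dotv (velocity H t) (LV t)
             + dotv (acceleration H t) (LW t) in
  integrable h /\ integ a b h = 0.
Proof.
move=> [Ha Hb H'a H'b] dLV dLW dQ1 h.
pose F t := \sum_(k < n) (position H t k 0 * (LV t k 0 + (-1) * Q1 t k 0)
                          + velocity H t k 0 * LW t k 0).
have dF : primitive_off_finite a b F h.
  (* The factors 0 and -1 come from the product rule applied to (-1) * Q1. *)
  have -> : h = fun t => \sum_(k < n)
      ((velocity H t k 0 * (LV t k 0 + (-1) * Q1 t k 0)
        + position H t k 0 * (P1 t k 0 + (0 * Q1 t k 0 + (-1) * Q2 t k 0)))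
       + (acceleration H t k 0 * LW t k 0 + velocity H t k 0 * Q1 t k 0)).
    apply/funext => t; rewrite /h !dotvE -!big_split/=; apply: eq_bigr => k _.
    by rewrite !mxE; ring.
  apply: primitive_off_finite_sum => k; apply: primitive_off_finiteD.
    apply: primitive_off_finiteM => //; first exact: is_D_coord (velocityP H).
    apply: primitive_off_finiteD; first exact: is_D_coord.
    apply: primitive_off_finiteM => //; last exact: is_D_coord.
    exact: primitive_off_finite_cst.
  apply: primitive_off_finiteM => //; first exact: is_D_coord (accelerationP H).
  exact: is_D_coord.
split; first by have [_ ch _] := dF; exact: piecewise_continuous_integrable.
rewrite (ftc_off_finite lt_ab dF) /F !big1 ?subrr// => k _;
  by rewrite ?Ha ?Hb ?H'a ?H'b !mxE !mul0r addr0.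
Qed.

(** The integrand of [Delta]. *)
Definition first_variation phi H U t : R :=
  dotv (position H t) (along (grad_x phi) U t)
  + dotv (velocity H t) (along (grad_v phi) U t)
  + dotv (acceleration H t) (along (grad_w phi) U t).

Lemma piecewise_continuous_first_variation phi H U : C1_integrand a b phi ->
  piecewise_continuous a b (first_variation phi H U).
Proof.
move=> [_ _ _ [cx cv cw]].
apply: piecewise_continuousD; first apply: piecewise_continuousD;
  apply: piecewise_continuous_dotv; do ?exact: piecewise_continuous_along.
- exact: piecewise_continuous_position.
- exact: piecewise_continuous_velocity.
- exact: piecewise_continuous_acceleration.
Qed.

End Trajectories.

(** * The blocks of constraints *)

Section Blocks.
Context {m r : nat} (J : 'I_r.+1 -> {set 'I_m}).
Hypothesis J_cover : (\bigcup_(al : 'I_r.+1) J al)%SET = [set: 'I_m]%SET.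
Hypothesis J_disj : forall al be : 'I_r.+1, al != be ->
  (J al :&: J be)%SET = finset.set0.

Lemma sum_blocks (V : nmodType) (c : 'I_m -> V) :
  \sum_(j in J ord0) c j + \sum_(al : 'I_r.+1 | (0 < al)%N) \sum_(j in J al) c j
  = \sum_j c j.
Proof.
transitivity (\sum_al \sum_(j in J al) c j).
  rewrite [RHS](bigD1 ord0)//=; congr (_ + _).
  by apply: eq_bigl => al; rewrite lt0n.
rewrite (exchange_big_dep xpredT)//=; apply: eq_bigr => j _.
have /bigcupP[al _ jal] : j \in (\bigcup_(al : 'I_r.+1) J al)%SET.
  by rewrite J_cover finset.inE.
rewrite (bigD1 al)//= big1 ?addr0// => be /andP[jbe].
move=> /J_disj /setP /(_ j); rewrite !finset.inE jal jbe //.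
Qed.

(** Since the lam i sum to 1, the block J_0 counted in every term of the weighted
    sum is counted exactly once in total. *)
Lemma sum_multiplier_blocks (R : realType) (V : lmodType R) (p : nat)
    (lam : 'cV[R]_p) (u l : 'I_p -> V) (c : 'I_m -> V) :
  \sum_i lam i 0 = 1 ->
  \sum_i lam i 0 *: (u i + \sum_(j in J ord0) c j + l i)
  + \sum_(al : 'I_r.+1 | (0 < al)%N) \sum_(j in J al) c j
  = \sum_i lam i 0 *: (u i + l i) + \sum_j c j.
Proof.
move=> lam1; rewrite -(sum_blocks c) addrA; congr (_ + _).
rewrite -[X in _ = _ + X]scale1r -lam1 scaler_suml -big_split/=.
by apply: eq_bigr => i _; rewrite -scalerDr addrAC.
Qed.

End Blocks.

(** * The mixed dual problem *)

(** First variations are sums of three dot products; the next lemmas handle such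
    sums for arbitrary vectors in place of gradients. *)

Section DotTriples.
Context {R : realType} {n : nat}.
Implicit Types h k l u v w : 'cV[R]_n.

Lemma dotv3D h k l u v w u' v' w' :
  (dotv h u + dotv k v + dotv l w) + (dotv h u' + dotv k v' + dotv l w')
  = dotv h (u + u') + dotv k (v + v') + dotv l (w + w').
Proof. by rewrite !dotvDr; ring. Qed.

Lemma dotv3_sum (I : finType) (P : pred I) h k l (u v w : I -> 'cV[R]_n) :
  dotv h (\sum_(i | P i) u i) + dotv k (\sum_(i | P i) v i)
    + dotv l (\sum_(i | P i) w i)
  = \sum_(i | P i) (dotv h (u i) + dotv k (v i) + dotv l (w i)).
Proof. by rewrite !dotv_sumr -!big_split. Qed.

Lemma dotv3_eq h k l u v w u' v' w' : u = u' -> v = v' -> w = w' ->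
  dotv h u + dotv k v + dotv l w = dotv h u' + dotv k v' + dotv l w'.
Proof. by move=> -> -> ->. Qed.

Lemma dotv3Z (c : R) h k l u v w :
  dotv h (c *: u) + dotv k (c *: v) + dotv l (c *: w)
  = c * (dotv h u + dotv k v + dotv l w).
Proof. by rewrite !dotvZr !mulrDr. Qed.

End DotTriples.

Section MixedDual.
Context {R : realType} {a b : R} {n p m r : nat}.
Variables (f : 'I_p -> @integrand R n) (g : 'I_m -> @integrand R n).
Variables (B : 'I_p -> R -> 'M[R]_n) (J : 'I_r.+1 -> {set 'I_m}).
Variables (y : R -> 'cV[R]_m) (z : 'I_p -> R -> 'cV[R]_n) (lam : 'cV[R]_p).
Hypothesis lt_ab : a < b.
Hypothesis f_C1 : forall i, C1_integrand a b (f i).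
Hypothesis g_C1 : forall j, C1_integrand a b (g j).
Implicit Types (X U H : trajectory a b n).
Local Notation mu := (@lebesgue_measure R).
Local Notation integrable h := (mu.-integrable `[a, b] (EFin \o h)).

Lemma grad_block (A : {set 'I_m}) (c : 'I_m -> R) (G : 'I_m -> 'cV[R]_n -> R)
    (v : 'cV[R]_n) :
  (forall j, has_partials (G j) v) ->
  has_partials (fun v' => \sum_(j in A) c j * G j v') v /\
  grad (fun v' => \sum_(j in A) c j * G j v') v
    = \sum_(j in A) c j *: grad (G j) v.
Proof.
move=> dG; have [dS ->] := grad_sum (index_enum 'I_m) (mem A)
  (fun j => has_partialsZ (c := c j) (dG j)).
by split; [exact: dS|apply: eq_bigr => j _; rewrite (gradZ _ (dG j))].
Qed.

Lemma grad_weighted (A : {set 'I_m}) (c : 'I_m -> R)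
    (G : 'I_m -> 'cV[R]_n -> R) (F L : 'I_p -> 'cV[R]_n -> R) (v : 'cV[R]_n) :
  (forall i, has_partials (F i) v) -> (forall j, has_partials (G j) v) ->
  (forall i, has_partials (L i) v) ->
  grad (fun v' => \sum_i lam i 0 *
    (F i v' + \sum_(j in A) c j * G j v' + L i v')) v
  = \sum_i lam i 0 *:
    (grad (F i) v + \sum_(j in A) c j *: grad (G j) v + grad (L i) v).
Proof.
move=> dF dG dL; have [dB gB] := grad_block A c dG.
have dFB i := has_partialsD (dF i) dB.
have dFBL i := has_partialsD (dFB i) (dL i).
have [_ ->] := grad_sum (index_enum 'I_p) xpredT
  (fun i => has_partialsZ (c := lam i 0) (dFBL i)).
apply: eq_bigr => i _.
by rewrite (gradZ _ (dFBL i)) (gradD (dFB i) (dL i)) (gradD (dF i) dB) gB.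
Qed.

Lemma C1_partials (phi : @integrand R n) t x v w : C1_integrand a b phi -> t \in `[a, b] ->
  [/\ has_partials (fun x' => phi t x' v w) x,
      has_partials (fun v' => phi t x v' w) v
    & has_partials (fun w' => phi t x v w') w].
Proof.
move=> [_ _ d _] tab.
split=> j; have [dx dv dw] := d t x v w j tab.
- exact: dx.
- exact: dv.
- exact: dw.
Qed.

Lemma grad_phi_block U t al : t \in `[a, b] ->
  [/\ along (grad_x (phi_block g J y al)) U t
        = \sum_(j in J al) y t j 0 *: along (grad_x (g j)) U t,
      along (grad_v (phi_block g J y al)) U t
        = \sum_(j in J al) y t j 0 *: along (grad_v (g j)) U t
    & along (grad_w (phi_block g J y al)) U t
        = \sum_(j in J al) y t j 0 *: along (grad_w (g j)) U t].
Proof.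
move=> tab.
have dg j := C1_partials (position U t) (velocity U t) (acceleration U t)
  (g_C1 j) tab.
split; apply: (grad_block _ _ _).2 => j; have [gx gv gw] := dg j.
- exact: gx.
- exact: gv.
- exact: gw.
Qed.

Lemma grad_phi0 U t : t \in `[a, b] ->
  [/\ along (grad_x (phi0 f g B J y z lam)) U t
        = \sum_i lam i 0 *: (along (grad_x (f i)) U t
            + \sum_(j in J ord0) y t j 0 *: along (grad_x (g j)) U t
            + B i t *m z i t),
      along (grad_v (phi0 f g B J y z lam)) U t
        = \sum_i lam i 0 *: (along (grad_v (f i)) U t
            + \sum_(j in J ord0) y t j 0 *: along (grad_v (g j)) U t + 0)
    & along (grad_w (phi0 f g B J y z lam)) U t
        = \sum_i lam i 0 *: (along (grad_w (f i)) U t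
            + \sum_(j in J ord0) y t j 0 *: along (grad_w (g j)) U t + 0)].
Proof.
move=> tab.
have df i := C1_partials (position U t) (velocity U t) (acceleration U t)
  (f_C1 i) tab.
have dg j := C1_partials (position U t) (velocity U t) (acceleration U t)
  (g_C1 j) tab.
split.
- rewrite /along /grad_x (grad_weighted _ _ _
    (L := fun i x' => dotv x' (B i t *m z i t))).
  + by apply: eq_bigr => i _; rewrite grad_dotv.
  + by move=> i; have [fx fv fw] := df i; exact: fx.
  + by move=> j; have [gx gv gw] := dg j; exact: gx.
  + by move=> i; exact: has_partials_dotv.
- rewrite /along /grad_v (grad_weighted _ _ _
    (L := fun i _ => dotv (position U t) (B i t *m z i t))).
  + by apply: eq_bigr => i _; rewrite grad_cst.
  + by move=> i; have [fx fv fw] := df i; exact: fv.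
  + by move=> j; have [gx gv gw] := dg j; exact: gv.
  + by move=> i; exact: has_partials_cst.
- rewrite /along /grad_w (grad_weighted _ _ _
    (L := fun i _ => dotv (position U t) (B i t *m z i t))).
  + by apply: eq_bigr => i _; rewrite grad_cst.
  + by move=> i; have [fx fv fw] := df i; exact: fw.
  + by move=> j; have [gx gv gw] := dg j; exact: gw.
  + by move=> i; exact: has_partials_cst.
Qed.

Lemma first_variation_eq (phi : @integrand R n) H U t (u v w : 'cV[R]_n) :
  [/\ along (grad_x phi) U t = u, along (grad_v phi) U t = v
    & along (grad_w phi) U t = w] ->
  first_variation phi H U t = dotv (position H t) u + dotv (velocity H t) v
                              + dotv (acceleration H t) w.
Proof.
by case=> <- <- <-.
Qed.

Lemma first_variation_block H U t al : t \in `[a, b] ->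
  first_variation (phi_block g J y al) H U t
  = \sum_(j in J al) y t j 0 * first_variation (g j) H U t.
Proof.
move=> tab; rewrite (first_variation_eq H (grad_phi_block U al tab)).
by rewrite dotv3_sum; apply: eq_bigr => j _; exact: dotv3Z.
Qed.

Hypothesis J_cover : (\bigcup_(al : 'I_r.+1) J al)%SET = [set: 'I_m]%SET.
Hypothesis J_disj : forall al be : 'I_r.+1, al != be ->
  (J al :&: J be)%SET = finset.set0.
Hypothesis lam1 : \sum_i lam i 0 = 1.

(** The functionals of the invexity hypotheses add up to the Lagrangian of the
    dual constraint. *)
Lemma sum_first_variations H U t : t \in `[a, b] ->
  first_variation (phi0 f g B J y z lam) H U t
  + \sum_(al : 'I_r.+1 | (0 < al)%N) first_variation (phi_block g J y al) H U t
  = dotv (position H t) (\sum_i lam i 0 *: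
      (along (grad_x (f i)) U t + B i t *m z i t
       + \sum_j y t j 0 *: along (grad_x (g j)) U t))
    + dotv (velocity H t) (lagr_grad f g (@grad_v R n) U y lam t)
    + dotv (acceleration H t) (lagr_grad f g (@grad_w R n) U y lam t).
Proof.
move=> tab.
have -> : \sum_(al : 'I_r.+1 | (0 < al)%N) first_variation (phi_block g J y al) H U t
  = dotv (position H t) (\sum_(al : 'I_r.+1 | (0 < al)%N)
      \sum_(j in J al) y t j 0 *: along (grad_x (g j)) U t)
  + dotv (velocity H t) (\sum_(al : 'I_r.+1 | (0 < al)%N)
      \sum_(j in J al) y t j 0 *: along (grad_v (g j)) U t)
  + dotv (acceleration H t) (\sum_(al : 'I_r.+1 | (0 < al)%N)
      \sum_(j in J al) y t j 0 *: along (grad_w (g j)) U t).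
  rewrite dotv3_sum; apply: eq_bigr => al _.
  by rewrite (first_variation_eq H (grad_phi_block U al tab)).
rewrite (first_variation_eq H (grad_phi0 U tab)) dotv3D.
have sumE u l c := sum_multiplier_blocks J_cover J_disj u l c lam1.
apply: dotv3_eq.
- rewrite (sumE _ (fun i => along (grad_x (f i)) U t)
    (fun i => B i t *m z i t) (fun j => y t j 0 *: along (grad_x (g j)) U t)).
  under [RHS]eq_bigr do rewrite scalerDr.
  by rewrite [RHS]big_split/= -scaler_suml lam1 scale1r.
- rewrite (sumE _ (fun i => along (grad_v (f i)) U t)
    (fun=> 0) (fun j => y t j 0 *: along (grad_v (g j)) U t)).
  by under eq_bigr do rewrite addr0.
- rewrite (sumE _ (fun i => along (grad_w (f i)) U t)
    (fun=> 0) (fun j => y t j 0 *: along (grad_w (g j)) U t)).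
  by under eq_bigr do rewrite addr0.
Qed.


Hypothesis y_int : forall j, integrable (fun t => y t j 0).

Lemma integrable_multiplier_constraint U j :
  integrable (fun t => y t j 0 * along (g j) U t).
Proof.
apply: integrable_mul_piecewise_continuous; first exact: y_int.
by apply: piecewise_continuous_along => //; have [cg _ _ _] := g_C1 j; exact: cg.
Qed.

Lemma integrable_first_variation_block H U al :
  integrable (first_variation (phi_block g J y al) H U).
Proof.
have iy j : integrable (fun t => y t j 0 * first_variation (g j) H U t).
  apply: integrable_mul_piecewise_continuous; first exact: y_int.
  exact: piecewise_continuous_first_variation.
apply: (integrable_eq _ (integ_sum (index_enum 'I_m) (mem (J al)) iy).1).
by move=> t tab; rewrite (first_variation_block H U al tab).
Qed.

Lemma functional_block U al : functional (phi_block g J y al) U =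
  \sum_(j in J al) integ a b (fun t => y t j 0 * along (g j) U t).
Proof.
exact: (integ_sum (index_enum 'I_m) (mem (J al))
  (integrable_multiplier_constraint U)).2.
Qed.

Hypothesis z_meas : forall i k, measurable_fun `[a, b] (fun t => z i t k 0).
Hypothesis B_sym : forall i t, t \in `[a, b] -> (B i t)^T = B i t.
Hypothesis B_psd : forall i t, t \in `[a, b] ->
  forall v : 'cV[R]_n, 0 <= dotv v (B i t *m v).
Hypothesis B_cont : forall i, {within `[a, b], continuous (B i)}.
Hypothesis z_ball : forall i t, t \in `[a, b] ->
  dotv (z i t) (B i t *m z i t) <= 1.

Lemma piecewise_continuous_entry i k l :
  piecewise_continuous a b (fun t => B i t k l).
Proof.
apply: (piecewise_continuous_comp_cont (F := fun A : 'M[R]_n => A k l)).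
  exact: coord_continuous.
exact: within_continuous_piecewise.
Qed.

Lemma dotv_mulmxE (A : 'M[R]_n) (u v : 'cV[R]_n) :
  dotv u (A *m v) = \sum_k u k 0 * \sum_l A k l * v l 0.
Proof. by rewrite dotvE; apply: eq_bigr => k _; rewrite mxE. Qed.

Lemma piecewise_continuous_sqrt_quad X i :
  piecewise_continuous a b
    (fun t => Num.sqrt (dotv (position X t) (B i t *m position X t))).
Proof.
apply: (piecewise_continuous_comp_cont (F := @Num.sqrt R)
  (v := fun t => dotv (position X t) (B i t *m position X t))).
  exact: sqrt_continuous.
under eq_fun do rewrite dotv_mulmxE.
have cX k := piecewise_continuous_coord k (piecewise_continuous_position lt_ab X).
apply: piecewise_continuous_sum => k; apply: piecewise_continuousM; first exact: cX.
apply: piecewise_continuous_sum => l; apply: piecewise_continuousM; last exact: cX.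
exact: piecewise_continuous_entry.
Qed.

Lemma dot_le_sqrt_quad X i t : t \in `[a, b] ->
  `|dotv (position X t) (B i t *m z i t)|
    <= Num.sqrt (dotv (position X t) (B i t *m position X t)).
Proof.
move=> tab; apply: psd_cauchy_schwarz; first exact: B_sym.
  exact: B_psd.
exact: z_ball.
Qed.

(** No bound on z itself is available where B is degenerate; integrability comes
    from the domination by the square root of the quadratic form. *)
Lemma integrable_dot X i :
  integrable (fun t => dotv (position X t) (B i t *m z i t)).
Proof.
have mdot : measurable_fun `[a, b]
    (fun t => dotv (position X t) (B i t *m z i t)).
  under [X in measurable_fun _ X]eq_fun do rewrite dotv_mulmxE.
  have mX k := piecewise_continuous_measurable
    (piecewise_continuous_coord k (piecewise_continuous_position lt_ab X)).
  apply: measurable_sum => k; apply: measurable_funM; first exact: mX.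
  apply: measurable_sum => l; apply: measurable_funM; last exact: z_meas.
  apply: piecewise_continuous_measurable; exact: piecewise_continuous_entry.
apply: (le_integrable _ _ _ (piecewise_continuous_integrable
  (piecewise_continuous_sqrt_quad X i))) => //.
  exact/measurable_EFinP.
move=> t tab /=; rewrite lee_fin [leRHS]ger0_norm ?sqrtr_ge0//.
exact: dot_le_sqrt_quad.
Qed.

Lemma integrable_cost X i : integrable (along (f i) X).
Proof.
apply: piecewise_continuous_integrable; apply: piecewise_continuous_along => //.
by have [cf _ _ _] := f_C1 i; exact: cf.
Qed.

Lemma integrable_MixD_objective X i :
  integrable (fun t => along (f i) X t + dotv (position X t) (B i t *m z i t)
                       + \sum_(j in J ord0) y t j 0 * along (g j) X t).
Proof.
apply: integrable_add; first apply: integrable_add.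
- exact: integrable_cost.
- exact: integrable_dot.
- exact: (integ_sum (index_enum 'I_m) (mem (J ord0))
    (integrable_multiplier_constraint X)).1.
Qed.

(** Stated for every trajectory X, so that it applies both to the dual feasible u
    and to the primal feasible x. *)
Lemma functional_phi0 X : functional (phi0 f g B J y z lam) X =
  \sum_i lam i 0 * MixD_objective f g B J X y z i.
Proof.
have iM i := integrable_scale (lam i 0) (integrable_MixD_objective X i).
transitivity (\sum_i integ a b (fun t => lam i 0 *
    (along (f i) X t + dotv (position X t) (B i t *m z i t)
     + \sum_(j in J ord0) y t j 0 * along (g j) X t))).
  rewrite -(integ_sum (index_enum 'I_p) xpredT iM).2; apply: integ_eq => t _.
  by apply: eq_bigr => i _; rewrite addrAC.
apply: eq_bigr => i _; apply: RintegralZl => //.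
exact: integrable_MixD_objective.
Qed.

Hypothesis y_ge0 : forall t j, t \in `[a, b] -> 0 <= y t j 0.

Lemma MixD_objective_le_VP X i : VP_feasible g X ->
  MixD_objective f g B J X y z i <= VP_objective f B X i.
Proof.
move=> [_ gX]; apply: le_Rintegral => //.
- exact: integrable_MixD_objective.
- apply: integrable_add; first exact: integrable_cost.
  apply: piecewise_continuous_integrable; exact: piecewise_continuous_sqrt_quad.
- move=> t tab; rewrite -addrA lerD2l -[leRHS]addr0; apply: lerD.
    exact: le_trans (ler_norm _) (dot_le_sqrt_quad X i tab).
  apply: sumr_le0 => j _; apply: mulr_ge0_le0; first exact: y_ge0.
  exact: gX.
Qed.

Lemma functional_block_feasible_le0 X al : VP_feasible g X ->
  functional (phi_block g J y al) X <= 0.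
Proof.
move=> [_ gX]; rewrite functional_block; apply: sumr_le0 => j _.
have -> : 0 = integ a b (fun=> 0) by rewrite /integ Rintegral_cst// mul0r.
apply: le_Rintegral => //.
- exact: integrable_multiplier_constraint.
- exact: integrable0.
- move=> t tab; apply: mulr_ge0_le0; first exact: y_ge0.
  exact: gX.
Qed.

(** Stationarity of u, integrated against H: after substitution of the dual
    constraint the sum of the integrands is the one of [by_parts_twice].
    The variation of [phi0] is the difference of that integrand and of the
    block variations, which are integrable, so that its integral splits. *)
Lemma sum_Delta_eq0 H U (P1 Q1 Q2 : R -> 'cV[R]_n) : clamped H ->
  is_D a b (lagr_grad f g (@grad_v R n) U y lam) P1 ->
  is_D a b (lagr_grad f g (@grad_w R n) U y lam) Q1 -> is_D a b Q1 Q2 ->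
  (forall t, t \in `[a, b] ->
    \sum_i lam i 0 *: (along (grad_x (f i)) U t + B i t *m z i t
                       + \sum_j y t j 0 *: along (grad_x (g j)) U t)
    - P1 t + Q2 t = 0) ->
  Delta (phi0 f g B J y z lam) H U
  + \sum_(al : 'I_r.+1 | (0 < al)%N) Delta (phi_block g J y al) H U = 0.
Proof.
move=> cH dv dw dQ stationary.
have [iT T0] := by_parts_twice lt_ab cH dv dw dQ.
have [iS sumS] := integ_sum (index_enum 'I_r.+1) (fun al => (0 < al)%N)
  (integrable_first_variation_block H U).
have totalE t : t \in `[a, b] ->
    first_variation (phi0 f g B J y z lam) H U t =
    (dotv (position H t) (P1 t - Q2 t)
     + dotv (velocity H t) (lagr_grad f g (@grad_v R n) U y lam t)
     + dotv (acceleration H t) (lagr_grad f g (@grad_w R n) U y lam t))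
    - \sum_(al : 'I_r.+1 | (0 < al)%N)
        first_variation (phi_block g J y al) H U t.
  move=> tab; have -> : P1 t - Q2 t = \sum_i lam i 0 *:
      (along (grad_x (f i)) U t + B i t *m z i t
       + \sum_j y t j 0 *: along (grad_x (g j)) U t).
    apply/eqP; rewrite eq_sym -subr_eq0 opprB addrA addrAC.
    exact/eqP/stationary.
  exact: (canRL (addrK _) (sum_first_variations H U tab)).
have -> : Delta (phi0 f g B J y z lam) H U = 0 - \sum_(al : 'I_r.+1 | (0 < al)%N)
    Delta (phi_block g J y al) H U.
  rewrite -[X in X - _]T0 -sumS -(RintegralB _ iT iS)//.
  exact: integ_eq.
by rewrite subrK.
Qed.

End MixedDual.

Theorem theorem1 (R : realType) (a b : R) (n p m r : nat)
  (f : 'I_p -> @integrand R n) (g : 'I_m -> @integrand R n)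
  (B : 'I_p -> R -> 'M[R]_n) (J : 'I_r.+1 -> {set 'I_m})
  (lt_ab : a < b)
  (f_C1 : forall i, C1_integrand a b (f i))
  (g_C1 : forall j, C1_integrand a b (g j))
  (B_sym : forall i t, t \in `[a, b] -> (B i t)^T = B i t)
  (B_psd : forall i t, t \in `[a, b] ->
     forall v : 'cV[R]_n, 0 <= dotv v (B i t *m v))
  (B_cont : forall i, {within `[a, b], continuous (B i)})
  (J_cover : (\bigcup_(al : 'I_r.+1) J al)%SET = [set: 'I_m]%SET)
  (J_disj : forall al be : 'I_r.+1, al != be -> (J al :&: J be)%SET = finset.set0)
  (invexity : exists eta : R -> 'cV[R]_n -> 'cV[R]_n -> 'cV[R]_n,
     forall (X U : trajectory a b n) (y : R -> 'cV[R]_m) (z : 'I_p -> R -> 'cV[R]_n)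
       (lam : 'cV[R]_p),
     VP_feasible g X -> MixD_feasible f g B J U y z lam ->
     exists H : trajectory a b n,
       [/\ eta_trajectory eta X U H,
           pseudoinvex_at (phi0 f g B J y z lam) H X U
         & forall al : 'I_r.+1, (0 < al)%N ->
             quasiinvex_at (phi_block g J y al) H X U])
  (X U : trajectory a b n) (y : R -> 'cV[R]_m) (z : 'I_p -> R -> 'cV[R]_n)
  (lam : 'cV[R]_p)
  (X_feas : VP_feasible g X) (U_feas : MixD_feasible f g B J U y z lam) :
  ~ ((forall i, VP_objective f B X i <= MixD_objective f g B J U y z i) /\
     (exists k, VP_objective f B X k < MixD_objective f g B J U y z k)).
Proof.
move=> [weak [k strict]].
have [eta /(_ X U y z lam X_feas U_feas) [H [[_ H0 H'0] pseudo quasi]]] := invexity.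
have [[Xa Xb X'a X'b] _] := X_feas.
have [[y_int z_meas] [[[Ua Ub U'a U'b] [P1 [Q1 [Q2 [dv dw dQ st]]]] blocks z_ball
  y_ge0] [lam_gt0 lam1]]] := U_feas.
have aab : a \in `[a, b] by rewrite in_itv/= lexx ltW.
have bab : b \in `[a, b] by rewrite in_itv/= lexx ltW.
have cH : clamped H.
  split; [apply: H0 => //|apply: H0 => //|apply: H'0 => //|apply: H'0 => //].
  - by rewrite Xa Ua.
  - by rewrite Xb Ub.
  - by rewrite X'a U'a.
  - by rewrite X'b U'b.
have D0 := sum_Delta_eq0 lt_ab f_C1 g_C1 J_cover J_disj lam1 y_int cH dv dw dQ st.
have block_le0 (al : 'I_r.+1) : (0 < al)%N -> Delta (phi_block g J y al) H U <= 0.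
  move=> al0; apply: quasi => //; apply: (@le_trans _ _ 0).
    exact: (functional_block_feasible_le0 J lt_ab g_C1 y_int y_ge0 al X_feas).
  by rewrite (functional_block J lt_ab g_C1 y_int); exact: blocks.
have phi0_ge0 : 0 <= Delta (phi0 f g B J y z lam) H U.
  have -> : Delta (phi0 f g B J y z lam) H U =
      - \sum_(al : 'I_r.+1 | (0 < al)%N) Delta (phi_block g J y al) H U.
    by apply/eqP; rewrite -addr_eq0 D0.
  by rewrite oppr_ge0; apply: sumr_le0 => al; exact: block_le0.
have phi0E := functional_phi0 J lam lt_ab f_C1 g_C1 y_int z_meas B_sym B_psd
  B_cont z_ball.
have := pseudo phi0_ge0; rewrite !phi0E.
apply/negP; rewrite -ltNge.
have leVP i := MixD_objective_le_VP J lt_ab f_C1 g_C1 y_int z_meas B_sym B_psd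
  B_cont z_ball y_ge0 i X_feas.
rewrite (bigD1 k)//= [ltRHS](bigD1 k)//=; apply: ltr_leD.
  by rewrite ltr_pM2l//; exact: le_lt_trans (leVP k) strict.
apply: ler_sum => i _; rewrite ler_pM2l//.
exact: le_trans (leVP i) (weak i).
Qed.
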